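(* Let $d\ge 1$, let $g:\mathbb R\to\mathbb R^d$ be a smooth flux, and let $G:\mathbb R^d\times\mathbb R\to\mathbb R$, $(x,v)\mapsto G(x,v)$, be continuously differentiable and non-decreasing in $v$ for every $x$. Let $F_{S0}=F_{S0}(t,x,v)$ be the solution of $$\partial_t F_{S0}+g'(v)\cdot\nabla_x F_{S0}=0\quad (t>0,\ x\in\mathbb R^d,\ v\in\mathbb R),\qquad F_{S0}(0,x,v)=G(x,v).$$ Then $F_{S0}(t,x,v)$ is non-decreasing in $v$ for all $(t,x,v)$ with $t\ge 0$ if and only if $g''(v)\cdot\nabla_x G(x,v)\le 0$ for all $(x,v)\in\mathbb R^d\times\mathbb R$.
   Context: Here $g'(v),g''(v)\in\mathbb R^d$ are the componentwise first and second derivatives of $g$, the dot is the Euclidean inner product on $\mathbb R^d$, and $v$ is an independent variable (a parameter in the equation). *)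

(* Defs.v *)
From HB Require Import structures.
From mathcomp Require Export all_boot all_order all_algebra.
From mathcomp Require Export all_classical all_reals all_analysis.
Export Order.TTheory GRing.Theory Num.Theory.
Export numFieldNormedType.Exports.

Set Implicit Arguments.
Unset Strict Implicit.
Unset Printing Implicit Defensive.

Local Open Scope classical_set_scope.
Local Open Scope ring_scope.

(* Row vectors carry the sup norm in the library; it is only used for the
   topology and for differentiability, so it is interchangeable with the
   Euclidean norm. *)

Definition dotv (R : realType) (d : nat) (a b : 'rV[R]_d) : R :=
  \sum_(i < d) a ord0 i * b ord0 i.

Definition grad (R : realType) (d : nat) (f : 'rV[R]_d -> R) (x : 'rV[R]_d)
    : 'rV[R]_d :=
  \row_(i < d) 'D_(delta_mx ord0 i) f x.

Definition deriv_vec (R : realType) (d n : nat) (g : R -> 'rV[R]_d) (v : R)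
    : 'rV[R]_d :=
  \row_(i < d) derive1n n (fun w : R => g w ord0 i) v.

Definition smooth_curve (R : realType) (d : nat) (g : R -> 'rV[R]_d) : Prop :=
  forall (i : 'I_d) (n : nat) (v : R),
    derivable (derive1n n (fun w : R => g w ord0 i)) v 1.

(* On a finite-dimensional V, continuity of p |-> 'D_h f p for each h is
   continuity of the differential p |-> 'd f p in operator norm. *)
Definition continuously_differentiable (R : realType) (V : normedModType R)
    (f : V -> R) : Prop :=
  (forall p, differentiable f p) /\ (forall h, continuous (fun p => 'D_h f p)).

(* Classical solutions. The equation contains no derivative in v, so no
   regularity in v is imposed. F is a total function, but its values at t < 0
   are irrelevant: differentiability and the equation are required only on the
   open half-space t > 0, and the initial data are attained through continuity
   on t >= 0. *)
Definition transport_solution (R : realType) (d : nat) (g : R -> 'rV[R]_d)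
    (G : 'rV[R]_d -> R -> R) (F : R -> 'rV[R]_d -> R -> R) : Prop :=
  [/\ forall v : R,
        {within [set p : R * 'rV[R]_d | 0 <= p.1],
          continuous (fun p : R * 'rV[R]_d => F p.1 p.2 v)},
      forall (v t : R) (x : 'rV[R]_d), 0 < t ->
        differentiable (fun p : R * 'rV[R]_d => F p.1 p.2 v) (t, x),
      forall (v t : R) (x : 'rV[R]_d), 0 < t ->
        derive1 (fun s : R => F s x v) t
          + dotv (deriv_vec 1 g v) (grad (fun y => F t y v) x) = 0
    & forall (x : 'rV[R]_d) (v : R), F 0 x v = G x v].

(* Main.v *)
Require Import Defs.
From mathcomp Require Import lra.

(** For fixed [v] the equation is a constant-coefficient transport equation in
    [(t, x)], so [F] is constant along the characteristic lines of velocity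
    [g'(v)] and
      [F t x v = G (x - t g'(v)) v] for [t >= 0]
    ([transport_solution_characteristics]).  Differentiating this formula in
    [v] ([is_derive_transported_data]) gives, at the foot point
    [y = x - t g'(v)],
      [dF/dv = - t (g''(v) . grad_x G(y, v)) + dG/dv(y, v)],
    where [dG/dv >= 0] since [G] is non-decreasing in [v].

    If [g'' . grad_x G <= 0] everywhere, both terms are non-negative and [F] is
    non-decreasing in [v].  Conversely, every [(y, v)] is the foot of a
    characteristic at every time [t], so monotonicity of [F] makes the
    right-hand side non-negative at [(y, v)] for all [t >= 0]; a positive value
    of [g'' . grad_x G] there would make it negative for large [t]. *)

Set Implicit Arguments.
Unset Strict Implicit.
Unset Printing Implicit Defensive.

Local Open Scope classical_set_scope.
Local Open Scope ring_scope.

(** Chain rule along a curve, with the derivative expressed through the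
    differential so that it can then be split into partial derivatives. *)
Lemma is_derive_diff_comp (R : numFieldType) (V W : normedModType R)
    (c : R -> V) (f : V -> W) (t : R) (dc : V) :
  is_derive t 1 c dc -> differentiable f (c t) ->
  is_derive t 1 (f \o c) ('d f (c t) dc).
Proof.
move=> [/derivable1_diffP dct <-] df.
apply: DeriveDef; first exact/derivable1_diffP/differentiable_comp.
rewrite (@deriveE _ R W (f \o c)); last exact: differentiable_comp.
by rewrite (@deriveE _ R V c)// diff_comp.
Qed.

Lemma differentiable_section_l (R : numFieldType) (U V W : normedModType R)
    (f : U * V -> W) (a : U) (b : V) :
  differentiable f (a, b) -> differentiable (fun y => f (y, b)) a.
Proof.
by move=> df; apply: (@differentiable_comp _ _ _ _ (fun y => (y, b)) f).
Qed.

Lemma differentiable_section_r (R : numFieldType) (U V W : normedModType R)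
    (f : U * V -> W) (a : U) (b : V) :
  differentiable f (a, b) -> differentiable (fun z => f (a, z)) b.
Proof.
by move=> df; apply: (@differentiable_comp _ _ _ _ (fun z => (a, z)) f).
Qed.

(** The differential is linear and [(h, k) = (h, 0) + (0, k)]; its restrictions
    to the two axes are the differentials of the sections of [f]. *)
Lemma diff_prodE (R : numFieldType) (U V W : normedModType R)
    (f : U * V -> W) (a h : U) (b k : V) :
  differentiable f (a, b) ->
  'd f (a, b) (h, k) =
  'd (fun y => f (y, b)) a h + 'd (fun z => f (a, z)) b k.
Proof.
move=> df.
have -> : (h, k) = (h, 0) + (0, k) :> U * V.
  by apply/pair_equal_spec; rewrite /= addr0 add0r.
rewrite linearD; congr (_ + _).
- have := @diff_comp _ _ _ _ (fun y : U => (y, b)) f a.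
  rewrite diff_pair// !diff_val => ->//; exact: differentiable_pair.
- have := @diff_comp _ _ _ _ (fun z : V => (a, z)) f b.
  rewrite diff_pair// !diff_val => ->//; exact: differentiable_pair.
Qed.

Lemma diff_dotv_grad (R : realType) (d : nat) (f : 'rV[R]_d -> R)
    (x h : 'rV[R]_d) :
  differentiable f x -> 'd f x h = dotv h (grad f x).
Proof.
move=> df; rewrite [in LHS](row_sum_delta h) linear_sum.
by apply: eq_bigr => i _; rewrite linearZ /= !mxE deriveE.
Qed.

Lemma is_derive_deriv_vec (R : realType) (d n : nat) (g : R -> 'rV[R]_d) (v : R) :
  smooth_curve g -> is_derive v 1 (deriv_vec n g) (deriv_vec n.+1 g v).
Proof.
move=> hg.
have coordE i : (fun w => deriv_vec n g w ord0 i) =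
                derive1n n (fun w => g w ord0 i).
  by apply/funext => w; rewrite mxE.
have dg : derivable (deriv_vec n g) v 1.
  by apply/derivable_mxP => i j; rewrite (ord1 i) coordE; exact: hg.
apply: DeriveDef => //; rewrite derive_mx//.
by apply/matrixP => i j; rewrite (ord1 i) !mxE coordE -derive1E.
Qed.

Lemma nondecreasing_derive_ge0 (R : realFieldType) (f : R -> R) (x df : R) :
  {homo f : v w / v <= w} -> is_derive x 1 f df -> 0 <= df.
Proof.
move=> fmono [fx <-].
apply: limr_ge => //; near=> h.
rewrite /= [h%:A]mulr1.
have [hgt|hle] := ltP 0 h.
  by rewrite mulr_ge0 ?invr_ge0 ?(ltW hgt)// subr_ge0 fmono// lerDr ltW.
rewrite mulr_le0// ?invr_le0// subr_le0 fmono//.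
by rewrite gerDr.
Unshelve. all: by end_near. Qed.

Lemma derive_ge0_nondecreasing (R : realType) (f df : R -> R) :
  (forall x : R, is_derive x 1 f (df x)) -> (forall x, 0 <= df x) ->
  {homo f : v w / v <= w}.
Proof.
move=> fdf df0 v w vw.
have fD (x : R) : derivable f x 1 by have [] := fdf x.
apply: (@ger0_derive1_ndecr _ f v w) => // [x _|].
- by rewrite derive1E derive_val.
- by apply: derivable_within_continuous => x _.
Qed.

(** Along [s |-> (s, y + s g'(v))] the chain rule turns the left-hand side of the
    equation into the derivative of [F], which therefore vanishes for [s > 0].
    As the equation says nothing at [s = 0], the mean value theorem is applied
    on [[0, t]], using that [F] is continuous up to [s = 0]. *)
Lemma transport_solution_characteristics (R : realType) (d : nat)
    (g : R -> 'rV[R]_d) (G : 'rV[R]_d -> R -> R) (F : R -> 'rV[R]_d -> R -> R)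
    (t v : R) (x : 'rV[R]_d) :
  transport_solution g G F -> 0 <= t ->
  F t x v = G (x - t *: deriv_vec 1 g v) v.
Proof.
move=> [Fcont Fdiff Feq F0] t0.
set c := deriv_vec 1 g v; set y := x - t *: c.
pose curve (s : R) : R * 'rV[R]_d := (s, s *: c + y).
pose f (p : R * 'rV[R]_d) := F p.1 p.2 v.
have curveD (s : R) : is_derive s 1 curve (1, c).
  have curve_diff : is_diff s curve (fun h => (h, h *: c + 0)).
    by apply: is_diff_pair.
  apply: DeriveDef; first exact/derivable1_diffP.
  by rewrite deriveE// diff_val scale1r addr0.
have fcurveD (s : R) : 0 < s -> is_derive s 1 (f \o curve) 0.
  move=> s0.
  have df := Fdiff v s (s *: c + y) s0.
  have := is_derive_diff_comp (curveD s) df.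
  rewrite diff_prodE//=.
  have dFt : differentiable (fun r => F r (s *: c + y) v) s.
    exact: (differentiable_section_l df).
  have dFx : differentiable (fun z => F s z v) (s *: c + y).
    exact: (differentiable_section_r df).
  by rewrite diff_dotv_grad// -derive1E'// Feq.
have fcurve_cont : {within `[0, t], continuous (f \o curve)}.
  apply/subspace_continuousP => s /=; rewrite in_itv/= => /andP[s0 st].
  have /subspace_continuousP/(_ (curve s) s0) := Fcont v.
  apply: cvg_comp => X; rewrite /within /= => DX.
  have curve_cont : {for s, continuous curve}.
    by apply/differentiable_continuous/derivable1_diffP; have [] := curveD s.
  (* The curve stays in the half-space where F is known to be continuous. *)
  have curve_near : \forall r \near s, 0 <= r -> X (curve r).
    exact: (curve_cont _ DX).
  suff : \forall r \near s, r \in `[0, t] -> X (curve r) by [].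
  near=> r; rewrite in_itv/= => /andP[r0 _].
  by move: r0; near: r.
have fcurveD' (s : R) : s \in `]0, t[ -> is_derive s 1 (f \o curve) 0.
  by rewrite in_itv/= => /andP[s0 _]; exact: fcurveD.
have [s _] := MVT_segment t0 fcurveD' fcurve_cont.
rewrite mul0r => /eqP; rewrite subr_eq0 => /eqP.
by rewrite /f /= F0 scale0r add0r /y addrC subrK.
Unshelve. all: by end_near. Qed.

(** Both arguments of [G] move with [v]: the foot point moves with velocity
    [- t g''(v)], the second argument with velocity 1. *)
Lemma is_derive_transported_data (R : realType) (d : nat) (g : R -> 'rV[R]_d)
    (G : 'rV[R]_d -> R -> R) (t v : R) (x : 'rV[R]_d) :
  smooth_curve g ->
  (forall p, differentiable (fun p : 'rV[R]_d * R => G p.1 p.2) p) ->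
  is_derive v 1 (fun w => G (x - t *: deriv_vec 1 g w) w)
    (- t * dotv (deriv_vec 2 g v)
                (grad (fun y => G y v) (x - t *: deriv_vec 1 g v))
     + 'd (G (x - t *: deriv_vec 1 g v)) v 1).
Proof.
move=> hg dG; set z := x - t *: deriv_vec 1 g v.
pose curve (w : R) : 'rV[R]_d * R := (x - t *: deriv_vec 1 g w, w).
have dg := is_derive_deriv_vec 1 v hg.
have dfoot : is_derive v 1 (fun w => x - t *: deriv_vec 1 g w)
                       (- t *: deriv_vec 2 g v).
  by apply: is_derive_eq; rewrite add0r scaleNr.
have dcurve : is_derive v 1 curve (- t *: deriv_vec 2 g v, 1).
  have [/derivable1_diffP dfootv footE] := dfoot.
  apply: DeriveDef; first exact/derivable1_diffP/differentiable_pair.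
  rewrite deriveE; last exact: differentiable_pair.
  by rewrite diff_pair// -deriveE// footE diff_val.
have := is_derive_diff_comp dcurve (dG (curve v)).
rewrite diff_prodE// diff_dotv_grad/=; last first.
  exact: (differentiable_section_l (dG (z, v))).
congr is_derive; congr (_ + _).
by rewrite /dotv mulr_sumr; apply: eq_bigr => i _; rewrite !mxE mulrA.
Qed.

Theorem theorem3p1 (R : realType) (d : nat) (hd : (1 <= d)%N)
    (g : R -> 'rV[R]_d) (hg : smooth_curve g)
    (G : 'rV[R]_d -> R -> R)
    (hG : continuously_differentiable (fun p : 'rV[R]_d * R => G p.1 p.2))
    (hGmono : forall x : 'rV[R]_d, {homo G x : v w / v <= w})
    (F : R -> 'rV[R]_d -> R -> R) (hF : transport_solution g G F) :
  (forall (t : R) (x : 'rV[R]_d), 0 <= t -> {homo F t x : v w / v <= w})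
  <->
  (forall (x : 'rV[R]_d) (v : R),
     dotv (deriv_vec 2 g v) (grad (fun y => G y v) x) <= 0).
Proof.
have dG := hG.1.
have FE t x : 0 <= t -> F t x = fun v => G (x - t *: deriv_vec 1 g v) v.
  move=> t0; apply/funext => v.
  exact: (transport_solution_characteristics v x hF t0).
have Gv_ge0 y v : 0 <= 'd (G y) v 1.
  apply: (nondecreasing_derive_ge0 (hGmono y)).
  have dGy : differentiable (G y) v.
    exact: (differentiable_section_r (dG (y, v))).
  by rewrite -deriveE//; exact/derivableP/diff_derivable.
split=> [Fmono y v | gG t x t0].
- rewrite leNgt; apply/negP => A0.
  set A := dotv _ _ in A0; set B := 'd (G y) v 1.
  (* At this time the derivative - t A + B of F equals - 1. *)
  pose t := (B + 1) / A.
  have t0 : 0 <= t by rewrite divr_ge0 ?(ltW A0)// addr_ge0 ?Gv_ge0.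
  have Fmono_t := Fmono t (y + t *: deriv_vec 1 g v) t0.
  rewrite FE// in Fmono_t.
  have := nondecreasing_derive_ge0 Fmono_t
    (is_derive_transported_data t v (y + t *: deriv_vec 1 g v) hg dG).
  by rewrite addrK -/A -/B mulNr divfK ?gt_eqF//; lra.
- rewrite FE//; apply: derive_ge0_nondecreasing => v.
    exact: is_derive_transported_data.
  by rewrite addr_ge0 ?Gv_ge0// mulNr -mulrN mulr_ge0// oppr_ge0.
Qed.
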